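(* Let $F$ be a field of characteristic zero. For any $\alpha\in F$, the algebra with trace $C_2^{t_{\alpha,1}}$ generates a variety of exponential growth.
   Context: $F$ is a field of characteristic 0. An algebra with trace is a unitary associative $F$-algebra $A$ with an $F$-linear map $\mathrm{tr}:A\to F$ such that $\mathrm{tr}(ab)=\mathrm{tr}(ba)$; a scalar is identified with the corresponding multiple of $1_A$. The free algebra with trace $F\langle X,\mathrm{Tr}\rangle\cong F\langle X\rangle\otimes F[\mathrm{Tr}(M)]$ on $X=\{x_1,x_2,\dots\}$ is generated by the free unitary associative algebra $F\langle X\rangle$ and central commuting indeterminates $\mathrm{Tr}(M)$, $M$ a nonempty word in $X$, subject to $\mathrm{Tr}(MN)=\mathrm{Tr}(NM)$ and $\mathrm{Tr}(\mathrm{Tr}(M)N)=\mathrm{Tr}(M)\mathrm{Tr}(N)$. An element is a trace identity of $A$ if it becomes $0$ whenever the variables are replaced by arbitrary elements of $A$ and $\mathrm{Tr}$ by $\mathrm{tr}$; $\mathrm{Id}^{tr}(A)$ is the set of trace identities of $A$. $MT_n$ is the space of multilinear elements of $F\langle X,\mathrm{Tr}\rangle$ in $x_1,\dots,x_n$ (the span of all products of traces of words times a word in which each of $x_1,\dots,x_n$ occurs exactly once in total), and $c_n^{tr}(A)=\dim_F MT_n/(MT_n\cap \mathrm{Id}^{tr}(A))$. The variety $\mathrm{var}^{tr}(A)$ generated by $A$ is the class of all algebras with trace satisfying all trace identities of $A$; its growth is the growth of the sequence $c_n^{tr}(A)$, and exponential growth means $c_n^{tr}(A)\ge C b^n$ for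 all $n\geq 1$, for some $C>0$, $b>1$. $C_2=\left\{\begin{pmatrix}a&b\\0&a\end{pmatrix}:a,b\in F\right\}$, and $C_2^{t_{\alpha,\beta}}$ is $C_2$ with the trace $t_{\alpha,\beta}\begin{pmatrix}a&b\\0&a\end{pmatrix}=\alpha a+\beta b$. *)

(* Defs.v *)
From HB Require Import structures.
From mathcomp Require Import all_boot all_order all_algebra.
From mathcomp Require Import generic_quotient finmap.
From mathcomp Require Import boolp classical_sets reals.
From mathcomp Require Import monalg.

Set Implicit Arguments.
Unset Strict Implicit.
Unset Printing Implicit Defensive.

Import Order.TTheory GRing.Theory Num.Theory.
Local Open Scope ring_scope.
Local Open Scope quotient_scope.

(* [algType] requires 1 <> 0, so the zero algebra is excluded. *)
Record trAlg (F : fieldType) := TrAlg {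
  tr_sort :> algType F;
  tr : {scalar tr_sort};
  trC : forall a b : tr_sort, tr (a * b) = tr (b * a)
}.

(* Words are sequences of letters; the letter i : nat stands for the variable x_{i+1}. *)
Definition nword := {w : seq nat | w != [::]}.

Definition cyc_rel (u v : nword) : bool :=
  [exists k : 'I_(size (val u)).+1, val v == rot k (val u)].

Lemma cyc_relP (u v : nword) :
  reflect (exists m n, val u = m ++ n /\ val v = n ++ m) (cyc_rel u v).
Proof.
apply: (iffP existsP) => [[k /eqP vE]|[m [n [uE vE]]]].
  by exists (take k (val u)), (drop k (val u)); rewrite cat_take_drop.
have mP : (size m < (size (val u)).+1)%N by rewrite ltnS uE size_cat leq_addr.
by exists (Ordinal mP); rewrite /= uE vE rot_size_cat.
Qed.

Fact cyc_rel_refl : reflexive cyc_rel.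
Proof. by move=> u; apply/cyc_relP; exists [::], (val u); rewrite cats0. Qed.

Fact cyc_rel_sym : symmetric cyc_rel.
Proof.
by move=> u v; apply/cyc_relP/cyc_relP => -[m [n [-> ->]]]; exists n, m.
Qed.

Fact cyc_rel_trans : transitive cyc_rel.
Proof.
move=> v u w /existsP[k /eqP vE] /existsP[l /eqP wE].
have kP : (k <= size (val u))%N by rewrite -ltnS ltn_ord.
have lP : (l <= size (val u))%N.
  by rewrite -(size_rot k (val u)) -vE -ltnS ltn_ord.
have {}wE : val w = rot l (rot k (val u)) by rewrite -vE.
apply/existsP; rewrite wE rot_add_mod //.
have jP : ((if l + k <= size (val u) then l + k else l + k - size (val u))
            < (size (val u)).+1)%N.
  by case: ifP => // _; rewrite ltnS leq_subLR leq_add.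
by exists (Ordinal jP).
Qed.

Canonical cyc_equiv :=
  EquivRel cyc_rel cyc_rel_refl cyc_rel_sym cyc_rel_trans.

(* The indeterminates Tr(M): nonempty words modulo Tr(MN) = Tr(NM). *)
Definition cword := {eq_quot cyc_equiv}.
HB.instance Definition _ := Choice.on cword.

Section ProdMonom.
Variables M N : monomType.
Implicit Types x y z : M * N.

Definition prod_mone : M * N := (mone, mone).
Definition prod_mmul x y : M * N := (mmul x.1 y.1, mmul x.2 y.2).

Fact prod_mmulA : associative prod_mmul.
Proof. by move=> x y z; rewrite /prod_mmul /= !mulmA. Qed.
Fact prod_mmul1m : left_id prod_mone prod_mmul.
Proof. by case=> x y; rewrite /prod_mmul /= !mul1m. Qed.
Fact prod_mmulm1 : right_id prod_mone prod_mmul.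
Proof. by case=> x y; rewrite /prod_mmul /= !mulm1. Qed.
Fact prod_munitm x y :
  prod_mmul x y = prod_mone -> x = prod_mone /\ y = prod_mone.
Proof.
case: x y => [x1 x2] [y1 y2] [] /unitm[-> ->] /unitm[-> ->].
by split.
Qed.

HB.instance Definition _ := Choice_isMonomialDef.Build (M * N)%type
  prod_mmulA prod_mmul1m prod_mmulm1 prod_munitm.
End ProdMonom.

(* (w, p) stands for w * \prod_c c ^ (p c): a word of F<X> times a monomial in
   the commuting indeterminates Tr(M), M taken up to cyclic rotation. *)
Definition tmonom := ({fmonom nat} * {cmonom cword})%type.
HB.instance Definition _ := MonomialDef.on tmonom.

(* The monoid algebra of the product monoid is F<X> \otimes F[Tr(M)]. *)
Definition freeTr (F : fieldType) := {malg F[tmonom]}.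
HB.instance Definition _ (F : fieldType) := GRing.Lalgebra.on (freeTr F).

Definition word_eval (F : fieldType) (A : algType F) (a : nat -> A)
  (w : seq nat) : A := \prod_(i <- w) a i.

(* By [tr_word_eval_repr] below, the choice of representative is immaterial. *)
Definition tmonom_eval (F : fieldType) (A : trAlg F) (a : nat -> A)
    (m : tmonom) : A :=
  (\prod_(c <- finsupp m.2) tr A (word_eval a (val (repr c))) ^+ m.2 c)
    *: word_eval a m.1.

Definition tr_eval (F : fieldType) (A : trAlg F) (a : nat -> A)
  (f : freeTr F) : A := mmap (in_alg A) (tmonom_eval a) f.

Lemma tr_word_eval_repr (F : fieldType) (A : trAlg F) (a : nat -> A)
    (u : nword) :
  tr A (word_eval a (val (repr (\pi u : cword)))) = tr A (word_eval a (val u)).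
Proof.
have /eqP : (repr (\pi u : cword)) = u %[mod cword] by rewrite reprK.
rewrite eqmodE => /cyc_relP[m [n [-> ->]]].
by rewrite /word_eval !big_cat trC.
Qed.

Definition Id_tr (F : fieldType) (A : trAlg F) : set (freeTr F) :=
  [set f | forall a : nat -> A, tr_eval a f = 0].

Definition letter_count (i : nat) (m : tmonom) : nat :=
  (count_mem i m.1
   + \sum_(c <- finsupp m.2) m.2 c * count_mem i (val (repr c)))%N.

(* x_1, ..., x_n each occur exactly once in total, other variables never. *)
Definition multilinear (n : nat) (m : tmonom) : Prop :=
  forall i, letter_count i m = (i < n)%N.

Definition MT (F : fieldType) (n : nat) : set (freeTr F) :=
  [set f | forall m, m \in msupp f -> multilinear n m].

(* The images of e form a basis of U / W, for subspaces W <= U of V. *)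
Definition quot_basis (F : fieldType) (V : lmodType F) (U W : set V)
    (d : nat) (e : 'I_d -> V) : Prop :=
  [/\ forall i, U (e i),
      forall k : 'I_d -> F, W (\sum_i k i *: e i) -> forall i, k i = 0
    & forall u, U u -> exists k : 'I_d -> F, W (u - \sum_i k i *: e i)].

(* The junk value 0 is taken only on infinite-dimensional quotients. *)
Definition quot_dim (F : fieldType) (V : lmodType F) (U W : set V) : nat :=
  xget 0%N [set d | exists e : 'I_d -> V, quot_basis U W e].

Definition tr_codim (F : fieldType) (A : trAlg F) (n : nat) : nat :=
  quot_dim (MT n) (MT n `&` Id_tr A)%classic.

Definition var_tr (F : fieldType) (A : trAlg F) (B : trAlg F) : Prop :=
  forall f, Id_tr A f -> Id_tr B f.

Definition exponential (R : realType) (c : nat -> nat) : Prop :=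
  exists C b : R, [/\ 0 < C, 1 < b
    & forall n, (0 < n)%N -> C * b ^+ n <= (c n)%:R].

(* [var_exponentialP] below: any generating algebra A gives the same notion. *)
Definition var_exponential (R : realType) (F : fieldType)
    (V : trAlg F -> Prop) : Prop :=
  exists A : trAlg F, (forall B, V B <-> var_tr A B)
    /\ exponential R (tr_codim A).

Lemma var_exponentialP (R : realType) (F : fieldType) (A : trAlg F) :
  var_exponential R (var_tr A) <-> exponential R (tr_codim A).
Proof.
split=> [[A' [AA' expA']]|expA]; last by exists A; split.
have AsubA' : var_tr A A' by apply/AA'.
have A'subA : var_tr A' A by apply/AA'.
have IdE : Id_tr A = Id_tr A'.
  by apply/funext => f; apply/propext; split=> [/AsubA'|/A'subA].
have -> : tr_codim A = tr_codim A' by rewrite /tr_codim IdE.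
exact: expA'.
Qed.

Section C2.
Variable F : fieldType.

(* The matrices [a b; 0 a]. *)
Definition C2_pred : {pred 'M[F]_2} :=
  [pred m : 'M[F]_2 | (m 1 0 == 0) && (m 0 0 == m 1 1)].

Let mulE (u v : 'M[F]_2) i j : (u * v) i j = u i 0 * v 0 j + u i 1 * v 1 j.
Proof.
rewrite mxE !big_ord_recl big_ord0 addr0.
by congr (_ + u _ _ * v _ _); apply: val_inj.
Qed.

Fact C2_subalg : subalg_closed C2_pred.
Proof.
split=> [|k u v|u v]; rewrite !inE.
- by rewrite !mxE !eqxx.
- move=> /andP[/eqP u0 /eqP u1] /andP[/eqP v0 /eqP v1].
  by rewrite !mxE u0 v0 u1 v1 mulr0 addr0 !eqxx.
- move=> /andP[/eqP u0 /eqP u1] /andP[/eqP v0 /eqP v1].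
  by rewrite !mulE u0 v0 u1 v1 !(mul0r, mulr0, add0r, addr0) !eqxx.
Qed.
HB.instance Definition _ :=
  GRing.isSubalgClosed.Build F 'M[F]_2 C2_pred
    (GRing.subalg_closed_semi C2_subalg).

Record C2 := MkC2 { C2val :> 'M[F]_2; _ : C2val \in C2_pred }.
HB.instance Definition _ := [isSub for C2val].
HB.instance Definition _ := [Choice of C2 by <:].
HB.instance Definition _ := [SubChoice_isSubAlgebra of C2 by <:].

Variables alpha beta : F.

Definition C2_trfun (m : C2) : F := alpha * m 0 0 + beta * m 0 1.

Fact C2_trfun_scalar : scalar C2_trfun.
Proof.
move=> k u v; rewrite /C2_trfun /= !mxE !mulrDr !(mulrCA _ k) -!addrA.
by congr (_ + _); rewrite addrCA.
Qed.
HB.instance Definition _ :=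
  GRing.isLinear.Build F C2 F _ C2_trfun C2_trfun_scalar.

Fact C2_trfunC (u v : C2) : C2_trfun (u * v) = C2_trfun (v * u).
Proof.
case: u v => [u /= uP] [v /= vP]; rewrite /C2_trfun /= !mulE.
move: uP vP; rewrite !inE => /andP[/eqP-> /eqP->] /andP[/eqP-> /eqP->].
by rewrite !mulr0 !addr0 (mulrC (v 1 1)) [X in _ + beta * X]addrC
           (mulrC (v 1 1)) (mulrC (v 0 1)).
Qed.

Definition C2_tr : trAlg F := @TrAlg F C2 C2_trfun C2_trfunC.
End C2.

(* Main.v *)
From HB Require Import structures.
Require Import Defs.
From mathcomp Require Import all_boot all_order all_algebra.
From mathcomp Require Import reals.
From mathcomp Require Import generic_quotient finmap.
From mathcomp Require Import boolp classical_sets.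
From mathcomp Require Import monalg.

Set Implicit Arguments.
Unset Strict Implicit.
Unset Printing Implicit Defensive.

Import GRing.Theory Num.Theory.
Local Open Scope ring_scope.
Local Open Scope quotient_scope.

(** The codimension c_n of C_2 with the trace t_(alpha, 1) is at least 2 ^ n,
    because the trace and the diagonal entry of a letter can be prescribed
    independently of each other: the coefficient of the off-diagonal entry in
    the trace is not 0.

    For S a subset of the n letters, let m_S be the product of the x_i with
    i in S, times the product of the traces Tr(x_i) with i not in S
    ([mixed_monom]). The map sending a matrix to its (0, 0) entry is a
    character of C_2, so for matrices x_i = (a_i, b_i; 0, a_i) the (0, 0)
    entry of m_S is
      (the product of the a_i, i in S) *
      (the product of the alpha a_i + b_i, i not in S).
    Given a subset T, put a_i = 1, b_i = - alpha for i in T, and a_i = 0,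
    b_i = 1 for i not in T. The first kind of matrix has (0, 0) entry 1 and
    trace 0, the second kind has (0, 0) entry 0 and trace 1; hence m_S takes
    the value 1 if S = T and 0 otherwise ([corner_eval_mixed_monom]). The
    2 ^ n functionals obtained from the subsets T kill the identities, so that
    the m_S are linearly independent modulo the identities
    ([dual_family_le], [tr_codim_C2_ge]).

    As [quot_dim] is 0 on a quotient without finite basis, this counts only
    once a finite basis of the quotient is known to exist. This holds for every
    algebra with trace ([tr_codim_basis]): there are finitely many multilinear
    monomials in n letters ([monom_code_inj]), so MT_n has finite dimension. *)

(** * Dimension of a quotient *)

Section QuotDim.
Variables (F : fieldType) (V : lmodType F) (U W : set V).

(** The values [L i (f j)] form the identity matrix of size [#|I|]; expanding
    each [f j] on the basis factors this matrix through dimension [d]. *)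
Lemma dual_family_le (I : finType) (d : nat) (e : 'I_d -> V) (f : I -> V)
    (L : I -> {scalar V}) :
    quot_basis U W e -> (forall i, U (f i)) ->
    (forall i w, W w -> L i w = 0) ->
    (forall i j, L i (f j) = (i == j)%:R) ->
  (#|I| <= d)%N.
Proof.
move=> [_ _ spanU] Uf LW Lf.
have /choice[K KP] j := spanU _ (Uf j).
pose A : 'M[F]_(#|I|, d) := \matrix_(j, k) K (enum_val j) k.
pose B : 'M[F]_(d, #|I|) := \matrix_(k, i) L (enum_val i) (e k).
suff AB1 : A *m B = 1%:M by exact: mulmx1_min AB1.
apply/matrixP => j i; rewrite !mxE.
have /eqP := LW (enum_val i) _ (KP (enum_val j)).
rewrite linearB subr_eq0 Lf linear_sum (inj_eq enum_val_inj) eq_sym.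
rewrite [i == j]eq_sym => /eqP <-.
by apply: eq_bigr => k _; rewrite !mxE linearZ.
Qed.

(** A family independent modulo [W] has independent images under [g], hence at
    most [N] elements; a family of maximal size is then a basis. *)
Lemma quot_basis_exists (N : nat) (g : {linear V -> 'rV[F]_N}) :
    (forall k u v, U u -> U v -> U (k *: u + v)) ->
    (forall k w, W w -> W (k *: w)) -> U 0 ->
    (forall u, U u -> g u = 0 -> W u) ->
  exists d, exists e : 'I_d -> V, quot_basis U W e.
Proof.
move=> Ulin Wscale U0 gW.
have Usum d (e : 'I_d -> V) (k : 'I_d -> F) :
    (forall i, U (e i)) -> U (\sum_i k i *: e i).
  move=> Ue; apply: (big_ind U) => // [u v Uu Uv|i _].
    by rewrite -[u]scale1r; apply: Ulin.
  by rewrite -[_ *: _]addr0; apply: Ulin.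
pose indep d := exists e : 'I_d -> V, (forall i, U (e i)) /\
  forall k : 'I_d -> F, W (\sum_i k i *: e i) -> forall i, k i = 0.
have indep_le d : `[< indep d >] -> (d <= N)%N.
  move=> /asboolP[e [Ue free_e]].
  pose A : 'M[F]_(d, N) := \matrix_i g (e i).
  suff /eqP <- : row_free A by exact: rank_leq_col.
  apply: inj_row_free => v vA0; apply/rowP => i; rewrite mxE.
  apply: (free_e (v 0)); apply: gW; first exact: Usum.
  apply: etrans vA0; rewrite linear_sum mulmx_sum_row.
  by apply: eq_bigr => j _; rewrite linearZ /= rowK.
have indep0 : exists d, `[< indep d >].
  by exists 0%N; apply/asboolP; exists (fun=> 0); split=> // k _ [].
case: (ex_maxnP indep0 indep_le) => d /asboolP[e [Ue free_e]] d_max.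
exists d, e; split=> // u Uu.
pose e' i := if unlift ord0 i is Some j then e j else u.
have sum_e' (k : 'I_d.+1 -> F) :
    \sum_i k i *: e' i = k ord0 *: u + \sum_i k (lift ord0 i) *: e i.
  rewrite big_ord_recl /e' unlift_none; congr (_ + _).
  by apply: eq_bigr => i _; rewrite liftK.
have /existsNP[k] : ~ forall k : 'I_d.+1 -> F,
    W (\sum_i k i *: e' i) -> forall i, k i = 0.
  move=> free_e'; suff /d_max : `[< indep d.+1 >] by rewrite ltnn.
  apply/asboolP; exists e'; split=> // i.
  by rewrite /e'; case: unliftP.
move=> /not_implyP[]; rewrite sum_e' => Wk kN0.
(* Otherwise the relation would involve the independent family [e] only. *)
have k0 : k ord0 != 0.
  apply/eqP => k0; apply: kN0 => i.
  move: Wk; rewrite k0 scale0r add0r => /free_e k'0.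
  by case: (unliftP ord0 i) => [j ->|->].
exists (fun i => - ((k ord0)^-1 * k (lift ord0 i))).
have := Wscale (k ord0)^-1 _ Wk.
rewrite scalerDr scalerA mulVf // scale1r scaler_sumr -sumrN.
by congr (W (_ + _)); apply: eq_bigr => i _; rewrite scalerA scaleNr opprK.
Qed.

End QuotDim.

(** * Finiteness of the multilinear monomials *)

Lemma val_repr_inj : injective (fun c : cword => val (repr c)).
Proof. by move=> c c' /val_inj rcc'; rewrite -[c]reprK rcc' reprK. Qed.

(** A word without repeated letters among n letters has length at most n. *)
Lemma bounded_word_encode n (s : seq nat) :
    (forall i, (count_mem i s <= (i < n))%N) ->
  exists w : n.-bseq 'I_n, map val w = s.
Proof.
move=> s_le.
have s_uniq : uniq s.
  apply: count_mem_uniq => i; have := s_le i.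
  rewrite -has_pred1 has_count.
  by case: (count _ _) => [|[|k]] //; case: (i < n)%N.
have s_lt : {in s, forall i, (i < n)%N}.
  move=> i; rewrite -has_pred1 has_count => /leq_trans/(_ (s_le i)).
  by case: (i < n)%N.
case: n s_lt {s_le} => [|n] s_lt.
  by exists [bseq]; case: s s_lt {s_uniq} => // i s /(_ i (mem_head _ _)).
have s_size : (size (map (@inord n) s) <= n.+1)%N.
  rewrite size_map -[leqRHS](size_iota 0); apply: uniq_leq_size => // i /s_lt.
  by rewrite mem_iota.
exists (Bseq s_size); rewrite /= -map_comp -[RHS]map_id.
by apply/eq_in_map => i /s_lt i_lt /=; rewrite inordK.
Qed.

Lemma multilinear_word_le n m i :
  multilinear n m -> (count_mem i m.1 <= (i < n))%N.
Proof. by move=> <-; apply: leq_addr. Qed.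

Lemma multilinear_trace_le n m (c : cword) i :
  multilinear n m -> (m.2 c * count_mem i (val (repr c)) <= (i < n))%N.
Proof.
move=> <-; case: (finsuppP m.2 c) => // cm.
by rewrite /letter_count (big_fsetD1 c) //= addnCA leq_addr.
Qed.

(** A trace occurring twice would repeat the letters of its nonempty word. *)
Lemma multilinear_exponent n m (c : cword) :
  multilinear n m -> c \in finsupp m.2 -> m.2 c = 1%N.
Proof.
move=> mn; rewrite -cmE_neq0 => mc0.
have : val (repr c) != [::] := valP (repr c).
case rE : (val (repr c)) => [//|i s] _.
have := multilinear_trace_le c i mn; rewrite rE /= eqxx mulnDr muln1.
by case: (m.2 c) mc0 => [//|[//|k]] _; case: (i < n)%N.
Qed.

(** The codes live in a finite type, which is what bounds the number of
    multilinear monomials. The exponents of the traces are forgotten, as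
    multilinearity forces them to be 0 or 1. The word is coded by the set of its
    encodings, so that no default value is needed for long words. *)
Definition monom_code n (m : tmonom) :
    {set n.-bseq 'I_n} * {set n.-bseq 'I_n} :=
  ([set w : n.-bseq 'I_n | map val w == m.1],
   [set w : n.-bseq 'I_n |
      has (fun c => map val w == val (repr c)) (finsupp m.2)]).

Lemma monom_code_inj n m m' : multilinear n m -> multilinear n m' ->
  monom_code n m = monom_code n m' -> m = m'.
Proof.
move=> mn mn' [/setP code1 /setP code2].
have E1 : m.1 = m'.1.
  have [w wE] := bounded_word_encode (fun i => multilinear_word_le i mn).
  have := code1 w; rewrite !inE wE eqxx => /esym /eqP m1E.
  by apply/eqP; rewrite fmP; apply/eqP.
have sub m1 m2 : multilinear n m1 ->
    (forall w, (w \in (monom_code n m1).2) = (w \in (monom_code n m2).2)) ->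
    (finsupp m1.2 `<=` finsupp m2.2)%fset.
  move=> mn1 E; apply/fsubsetP => c cm.
  have [w wE] : exists w : n.-bseq 'I_n, map val w = val (repr c).
    apply: bounded_word_encode => i.
    have := multilinear_trace_le c i mn1.
    by rewrite (multilinear_exponent mn1) ?mul1n.
  have := E w; rewrite !inE wE.
  have -> : has (fun c' : cword => val (repr c) == val (repr c'))
              (finsupp m1.2).
    by apply/hasP; exists c.
  by move=> /esym /hasP[c' c'm /eqP /val_repr_inj ->].
have E2 : finsupp m.2 = finsupp m'.2.
  by apply/eqP; rewrite eqEfsubset !sub.
case: m m' mn mn' E1 E2 {code1 code2} => [m1 m2] [m1' m2'] /= mn mn' -> E2.
congr (_, _); apply/eqP/cmP => c; case: (finsuppP m2 c) => cm.
  by rewrite fsfun_dflt // -E2.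
by rewrite (multilinear_exponent mn cm) (multilinear_exponent mn') // -E2.
Qed.

Section MTBasis.
Variables (F : fieldType) (n : nat).

Lemma MT_lin k (u v : freeTr F) : MT n u -> MT n v -> MT n (k *: u + v).
Proof.
move=> Un Vn m /(fsubsetP (msuppD_le _ _)); rewrite in_fsetU => /orP[|/Vn //].
by move=> /(fsubsetP (msuppZ_le _ _)) /Un.
Qed.

Lemma MT0 : MT n (0 : freeTr F).
Proof. by move=> m; rewrite msupp0. Qed.

Definition monom_decode x : tmonom :=
  xget mone [set m | multilinear n m /\ monom_code n m = x]%classic.

Lemma monom_codeK m : multilinear n m -> monom_decode (monom_code n m) = m.
Proof.
move=> mn; rewrite /monom_decode.
case: xgetP => [m' _ [mn' /monom_code_inj]|/(_ m) []]; last by [].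
exact.
Qed.

(** Coordinates of [f] on the multilinear monomials, with repetitions: codes
    of no multilinear monomial all decode to 1. *)
Definition coefs (f : freeTr F) :
    'rV[F]_#|{: {set n.-bseq 'I_n} * {set n.-bseq 'I_n}}| :=
  \row_i mcoeff (monom_decode (enum_val i)) f.

Fact coefs_linear : linear coefs.
Proof. by move=> k u v; apply/rowP => i; rewrite !mxE mcoeffD mcoeffZ. Qed.

HB.instance Definition _ :=
  GRing.isLinear.Build F (freeTr F) _ _ coefs coefs_linear.

Lemma coefs_eq0 f : MT n f -> coefs f = 0 -> f = 0.
Proof.
move=> fn f0; apply/malgP => m; rewrite mcoeff0.
case: (msuppP f m) => // /fn mn.
move/rowP: f0 => /(_ (enum_rank (monom_code n m))).
by rewrite !mxE enum_rankK monom_codeK.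
Qed.

End MTBasis.

(** * Codimensions are dimensions of finite-dimensional spaces *)

Section Eval.
Variables (F : fieldType) (A : trAlg F) (a : nat -> A).

Lemma tr_evalD f g : tr_eval a (f + g) = tr_eval a f + tr_eval a g.
Proof. exact: mmapD. Qed.

Lemma tr_evalZ k f : tr_eval a (k *: f) = k *: tr_eval a f.
Proof.
rewrite /tr_eval (mmapEw (msuppZ_le k f)) mmapE scaler_sumr.
by apply: eq_bigr => m _; rewrite mcoeffZ /= !mulr_algl [RHS]scalerA !scalerA.
Qed.

Lemma tr_evalU m : tr_eval a << m >> = tmonom_eval a m.
Proof. by rewrite /tr_eval mmapU /= scale1r mul1r. Qed.

End Eval.

Section Codim.
Variables (F : fieldType) (A : trAlg F) (n : nat).

Lemma tr_codim_basis :
  exists e : 'I_(tr_codim A n) -> freeTr F,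
    quot_basis (MT n) (MT n `&` Id_tr A)%classic e.
Proof.
apply: (@xgetPex _ 0%N
  (fun d => exists e : 'I_d -> freeTr F, quot_basis _ _ e)).
have IdZ k (f : freeTr F) : Id_tr A f -> Id_tr A (k *: f).
  by move=> f0 a; rewrite tr_evalZ f0 scaler0.
have Id0 : Id_tr A 0 by rewrite -[0](scale0r 0) => a; rewrite tr_evalZ scale0r.
apply: (quot_basis_exists (g := @coefs F n)).
- exact: MT_lin.
- move=> k f [fn fI]; split; last exact: IdZ.
  by rewrite -[_ *: _]addr0; apply: MT_lin => //; apply: MT0.
- exact: MT0.
- by move=> f fn /(coefs_eq0 fn) ->; split=> //; apply: MT0.
Qed.

End Codim.

(** * Monomials mixing a word with traces of letters *)

Section MixedMonom.
Variable n : nat.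
Implicit Types S T : {set 'I_n}.

Definition letter_word (i : nat) : nword := exist _ [:: i] isT.

Definition letter (i : nat) : cword := \pi_cword (letter_word i).

(** A one-letter word is its only cyclic rotation. *)
Lemma repr_letter i : val (repr (letter i)) = [:: i].
Proof.
have /eqP : repr (letter i) = letter_word i %[mod cword] by exact: reprK.
rewrite eqmodE => /cyc_relP[u [v [-> /=]]].
by case: v => [|j [|? ?]]; case: u => [|? [|? ?]] //= [->].
Qed.

Lemma letter_inj : injective letter.
Proof.
by move=> i j ij; have := repr_letter i; rewrite ij repr_letter => -[].
Qed.

Definition indic_cmonom (s : {fset cword}) : {cmonom cword} :=
  [cmonom 1 | _ in s]%M.

Definition mixed_monom S : tmonom :=
  (fmonom_of_seq fmonom_key [seq val i | i in S],
   indic_cmonom [fset letter (val i) | i in ~: S]%fset).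

Lemma indic_cmonomE s c : indic_cmonom s c = (c \in s).
Proof. by rewrite cmE fsfunE; case: ifP. Qed.

Lemma finsupp_indic_cmonom s : finsupp (indic_cmonom s) = s.
Proof.
by apply/fsetP => c; rewrite -cmE_neq0 indic_cmonomE; case: (c \in s).
Qed.

Lemma big_mixed_monom_traces (R : Type) (idx : R) (op : Monoid.com_law idx)
    S (G : cword -> R) :
  \big[op/idx]_(c <- finsupp (mixed_monom S).2) G c =
  \big[op/idx]_(i in ~: S) G (letter i).
Proof.
rewrite finsupp_indic_cmonom big_imfset /=; last first.
  by move=> i j _ _ /letter_inj/val_inj.
by rewrite big_enum.
Qed.

Lemma mixed_monom_exponent S (i : 'I_n) :
  i \in ~: S -> (mixed_monom S).2 (letter i) = 1%N.
Proof.
move=> iS; rewrite indic_cmonomE.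
suff -> : letter i \in [fset letter (val j) | j in ~: S]%fset by [].
by apply/imfsetP; exists i.
Qed.

Lemma mixed_monom_multilinear S : multilinear n (mixed_monom S).
Proof.
move=> i; rewrite /letter_count.
have -> : (\sum_(c <- finsupp (mixed_monom S).2)
      (mixed_monom S).2 c * count_mem i (val (repr c)) =
    \sum_(j in ~: S) (val j == i))%N.
  rewrite big_mixed_monom_traces; apply: eq_bigr => j jS.
  by rewrite repr_letter mixed_monom_exponent //= addn0 mul1n.
have -> : count_mem i (mixed_monom S).1 = (\sum_(j in S) (val j == i))%N.
  rewrite /= fmE /= -sum1_count big_map big_mkcond big_enum /=.
  by apply: eq_bigr => j _; rewrite eq_sym; case: eqP.
rewrite [X in (_ + X)%N](eq_bigl (fun j => j \notin S)); last first.
  by move=> j; rewrite inE.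
rewrite -(bigID (mem S) xpredT) /=.
case: ltnP => i_n.
  rewrite (bigD1 (Ordinal i_n)) //= eqxx big1 // => j.
  by rewrite -val_eqE /= => /negPf ->.
by rewrite big1 // => j _; case: eqP (ltn_ord j) => // ->; rewrite ltnNge i_n.
Qed.

Lemma mixed_monom_eval (F : fieldType) (A : trAlg F) (a : nat -> A) S :
  tmonom_eval a (mixed_monom S) =
    (\prod_(i in ~: S) tr A (a i)) *: \prod_(i <- enum S) a (val i).
Proof.
rewrite /tmonom_eval big_mixed_monom_traces /word_eval /= fmE big_map.
congr (_ *: _); apply: eq_bigr => i iS.
by rewrite repr_letter big_seq1 mixed_monom_exponent.
Qed.

End MixedMonom.

(** * Test points in C_2 *)

Section C2TestPoints.
Variables (F : fieldType) (alpha : F).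

(** The quotient of C_2 by its nilpotent ideal, a character of C_2. *)
Definition corner (u : C2 F) : F := u 0 0.

Fact corner_scalar : scalar corner.
Proof. by move=> k u v; rewrite /corner /= !mxE. Qed.
HB.instance Definition _ :=
  GRing.isLinear.Build F (C2 F) F _ corner corner_scalar.

Lemma cornerM u v : corner (u * v) = corner u * corner v.
Proof.
rewrite /corner /= mxE !big_ord_recl big_ord0 addr0.
case: v => v /= /andP[/eqP v10 _].
have -> : lift ord0 ord0 = 1 :> 'I_2 by apply: val_inj.
by rewrite v10 mulr0 addr0.
Qed.

Lemma corner1 : corner 1 = 1.
Proof. by rewrite /corner /= mxE eqxx. Qed.

Definition C2mx (x y : F) : 'M[F]_2 :=
  \matrix_(i, j) (x *+ (i == j) + y *+ (i < j)%N).

Fact C2mxP x y : C2mx x y \in @C2_pred F.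
Proof. by rewrite inE !mxE /= !addr0 !eqxx. Qed.

Definition C2mk x y := MkC2 (C2mxP x y).

Lemma corner_mk x y : corner (C2mk x y) = x.
Proof. by rewrite /corner /= mxE /= addr0. Qed.

Lemma tr_mk x y : tr (C2_tr alpha 1) (C2mk x y) = alpha * x + y.
Proof. by rewrite /= /C2_trfun /= !mxE /= addr0 add0r mul1r. Qed.

Variable n : nat.
Implicit Types S T : {set 'I_n}.

(** Entries are chosen so that exactly one of the trace and the (0, 0) entry
    is 1 and the other is 0. *)
Definition test_point T (i : nat) : C2_tr alpha 1 :=
  if i \in [seq val j | j in T] then C2mk 1 (- alpha) else C2mk 0 1.

Lemma test_pointE T (i : 'I_n) :
  test_point T i = if i \in T then C2mk 1 (- alpha) else C2mk 0 1.
Proof. by rewrite /test_point mem_map ?mem_enum //; apply: val_inj. Qed.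

Definition corner_eval T (f : freeTr F) : F :=
  corner (tr_eval (test_point T) f).

Fact corner_eval_scalar T : scalar (corner_eval T).
Proof. by move=> k u v; rewrite /corner_eval tr_evalD tr_evalZ linearP. Qed.
HB.instance Definition _ T :=
  GRing.isLinear.Build F (freeTr F) F _ (corner_eval T) (corner_eval_scalar T).

(** A letter in exactly one of [S] and [T] yields a vanishing factor: its trace
    is 0 if it lies in [T] only, its (0, 0) entry is 0 if it lies in [S]
    only. *)
Lemma corner_eval_mixed_monom T S :
  corner_eval T << mixed_monom S >> = (T == S)%:R.
Proof.
rewrite /corner_eval tr_evalU mixed_monom_eval linearZ /=.
have -> : corner (\prod_(i <- enum S) test_point T (val i)) =
    \prod_(i in S) (i \in T)%:R.
  rewrite (big_morph _ cornerM corner1) big_enum; apply: eq_bigr => i _.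
  by rewrite test_pointE; case: ifP; rewrite corner_mk.
have -> : \prod_(i in ~: S) tr (C2_tr alpha 1) (test_point T i) =
    \prod_(i in ~: S) (i \notin T)%:R.
  apply: eq_bigr => i _; rewrite test_pointE; case: ifP; rewrite tr_mk.
    by rewrite mulr1 subrr.
  by rewrite mulr0 add0r.
case: eqVneq => [->|/eqP TS].
  rewrite !big1 ?mulr1 // => i; first by move=> ->.
  by rewrite inE => ->.
apply/eqP; rewrite mulf_eq0.
have : [exists i, (i \in T) != (i \in S)].
  apply: contra_notT TS => /existsPn TS.
  by apply/setP => i; have := TS i; rewrite negbK => /eqP.
case/existsP => i; case iS: (i \in S); case iT: (i \in T) => // _.
  by rewrite (bigD1 i (P := mem S)) //= iT mul0r eqxx orbT.
by rewrite (bigD1 i) ?inE ?iS //= iT mul0r eqxx.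
Qed.

Lemma tr_codim_C2_ge : (2 ^ n <= tr_codim (C2_tr alpha 1) n)%N.
Proof.
have [e eB] := tr_codim_basis (C2_tr alpha 1) n.
rewrite -[X in (2 ^ X)%N]card_ord -cardsT -card_powerset powersetT cardsT.
apply: (dual_family_le (f := fun S => << mixed_monom S >>)
  (L := fun T => corner_eval T) eB).
- by move=> S m; rewrite msuppU1 inE => /eqP ->; apply: mixed_monom_multilinear.
- by move=> T w [_ w0]; rewrite /= /corner_eval w0 linear0.
- exact: corner_eval_mixed_monom.
Qed.

End C2TestPoints.

Theorem theorem20 (R : realType) (F : fieldType)
    (charF0 : [pchar F] =i pred0) (alpha : F) :
  var_exponential R (var_tr (C2_tr alpha 1)).
Proof.
apply/var_exponentialP; exists 1, 2; split; rewrite ?ltr01 ?ltr1n // => n _.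
by rewrite mul1r -natrX ler_nat tr_codim_C2_ge.
Qed.
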